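(* Let $k:A\to B$ be a homomorphism of weak Hopf algebras over a field $\mathbb{F}$. If $B$ is semisimple and $B\cdot\mathrm{Inv}_A(k^*(B))=k(A)\cdot\mathrm{Inv}_A(k^*(B))$, then $k$ is Inv-normal.
   Context: Fix a field $\mathbb{F}$. Sweedler notation without summation sign is used: $\Delta(a)=a^{(1)}\otimes a^{(2)}$. A weak Hopf algebra is a unital associative algebra $A$ that is also a coassociative counital coalgebra, with a linear map $S:A\to A$, such that for all $a,b,c\in A$: $\Delta(ab)=\Delta(a)\Delta(b)$; $(\Delta\otimes\mathrm{id})\Delta(1)=(\Delta(1)\otimes 1)(1\otimes\Delta(1))=(1\otimes\Delta(1))(\Delta(1)\otimes 1)$; $\epsilon(abc)=\epsilon(ab^{(1)})\epsilon(b^{(2)}c)=\epsilon(ab^{(2)})\epsilon(b^{(1)}c)$; $a^{(1)}S(a^{(2)})=\epsilon(1^{(1)}a)1^{(2)}$; $S(a^{(1)})a^{(2)}=1^{(1)}\epsilon(a1^{(2)})$; $S(a^{(1)})a^{(2)}S(a^{(3)})=S(a)$. Put $\epsilon_t(a)=a^{(1)}S(a^{(2)})$. A weak Hopf algebra homomorphism is a unital algebra homomorphism that is a counital coalgebra homomorphism and commutes with antipodes. $\mathrm{Rep}(B)$ is the category of finite-dimensional left $B$-modules; $k^*$ denotes restriction of scalars along $k$ from $B$-modules to $A$-modules; $k^*(B)$ is $B$ as a left $A$-module via $k$ and left multiplication. For a left $A$-module $M$, $\mathrm{Inv}_A(M)=\{m\in M\mid a\cdot m=\epsilon_t(a)\cdot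 m\ \ \forall a\in A\}$. The homomorphism $k$ is Inv-normal if $B\cdot\mathrm{Inv}_A(k^*(M))=k(A)\cdot\mathrm{Inv}_A(k^*(M))$ for every $M\in\mathrm{Rep}(B)$ (products denote linear spans). *)

(* Defs.v *)
From HB Require Import structures.
From mathcomp Require Import all_boot all_order all_algebra generic_quotient.
From mathcomp Require Import boolp classical_sets.

Set Implicit Arguments.
Unset Strict Implicit.
Unset Printing Implicit Defensive.

Import GRing.Theory.

Local Open Scope classical_set_scope.
Local Open Scope ring_scope.
Local Open Scope quotient_scope.

(* Tensor product of two (possibly infinite-dimensional) vector spaces: formal *)
(* sums of pairs modulo the congruence generated by bilinearity.               *)

Inductive tens_rel (F : fieldType) (V W : lmodType F) :
    seq (V * W) -> seq (V * W) -> Prop :=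
| tens_refl s : tens_rel s s
| tens_sym s t : tens_rel s t -> tens_rel t s
| tens_trans t s u : tens_rel s t -> tens_rel t u -> tens_rel s u
| tens_cat s s' t t' :
    tens_rel s s' -> tens_rel t t' -> tens_rel (s ++ t) (s' ++ t')
| tens_catC s t : tens_rel (s ++ t) (t ++ s)
| tens_addl v v' w : tens_rel [:: (v + v', w)] [:: (v, w); (v', w)]
| tens_addr v w w' : tens_rel [:: (v, w + w')] [:: (v, w); (v, w')]
| tens_scale c v w : tens_rel [:: (c *: v, w)] [:: (v, c *: w)]
| tens_zero w : tens_rel [:: (0, w)] [::].
Arguments tens_zero {F V W}.

Section Tensor.
Variables (F : fieldType) (V W : lmodType F).
Implicit Types (s t : seq (V * W)).

Definition tens_relb : rel (seq (V * W)) := fun s t => `[< tens_rel s t >].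

Lemma tens_relb_refl : reflexive tens_relb.
Proof. by move=> s; apply/asboolP/tens_refl. Qed.

Lemma tens_relb_sym : symmetric tens_relb.
Proof.
by move=> s t; apply/idP/idP => /asboolP h; apply/asboolP/tens_sym.
Qed.

Lemma tens_relb_trans : transitive tens_relb.
Proof.
by move=> t s u /asboolP h1 /asboolP h2; apply/asboolP/(tens_trans h1 h2).
Qed.

Canonical tens_equiv := EquivRel tens_relb tens_relb_refl tens_relb_sym tens_relb_trans.

Definition tensor := {eq_quot tens_equiv}.

HB.instance Definition _ := Choice.on tensor.
HB.instance Definition _ := EqQuotient.on tensor.

Lemma tens_eqP s t : \pi_tensor s = \pi_tensor t <-> tens_rel s t.
Proof.
by split=> [/eqmodP /asboolP //|h]; apply/eqmodP/asboolP.
Qed.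

Lemma tens_repr s : tens_rel (repr (\pi_tensor s)) s.
Proof. by apply/tens_eqP; rewrite reprK. Qed.

Lemma tensW (P : tensor -> Prop) : (forall s, P (\pi_tensor s)) -> forall x, P x.
Proof. by move=> h x; rewrite -[x]reprK. Qed.

Definition tens0 : tensor := \pi_tensor [::].
Definition tens_add (x y : tensor) : tensor := \pi_tensor (repr x ++ repr y).
Definition scale_seq c s := [seq (c *: p.1, p.2) | p <- s].
Definition tens_scalev (c : F) (x : tensor) : tensor := \pi_tensor (scale_seq c (repr x)).
Definition tens_opp (x : tensor) : tensor := tens_scalev (-1) x.

Lemma tens_addE s t : tens_add (\pi_tensor s) (\pi_tensor t) = \pi_tensor (s ++ t).
Proof.
by rewrite /tens_add; apply/tens_eqP; apply: tens_cat; apply: tens_repr.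
Qed.

Lemma scale_seq_rel c s t : tens_rel s t -> tens_rel (scale_seq c s) (scale_seq c t).
Proof.
elim=> {s t}.
- by move=> s; apply: tens_refl.
- by move=> s t _; apply: tens_sym.
- by move=> t s u _ h1 _ h2; apply: tens_trans h1 h2.
- by move=> s s' t t' _ h1 _ h2; rewrite /scale_seq !map_cat; apply: tens_cat.
- by move=> s t; rewrite /scale_seq !map_cat; apply: tens_catC.
- by move=> v v' w; rewrite /= scalerDr; apply: tens_addl.
- by move=> v w w' /=; apply: tens_addr.
- move=> d v w /=.
  by rewrite scalerA mulrC -scalerA; apply: tens_scale.
- by move=> w; rewrite /= scaler0; apply: tens_zero.
Qed.

Lemma tens_scaleE c s : tens_scalev c (\pi_tensor s) = \pi_tensor (scale_seq c s).
Proof.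
by rewrite /tens_scalev; apply/tens_eqP; apply/scale_seq_rel/tens_repr.
Qed.

Lemma tens_addA : associative tens_add.
Proof.
by elim/tensW=> s; elim/tensW=> t; elim/tensW=> u; rewrite !tens_addE catA.
Qed.

Lemma tens_addC : commutative tens_add.
Proof.
by elim/tensW=> s; elim/tensW=> t; rewrite !tens_addE; apply/tens_eqP/tens_catC.
Qed.

Lemma tens_add0 : left_id tens0 tens_add.
Proof. by elim/tensW=> s; rewrite tens_addE. Qed.

Lemma tens_scaleDl c d x :
  tens_scalev (c + d) x = tens_add (tens_scalev c x) (tens_scalev d x).
Proof.
elim/tensW: x => s; rewrite !tens_scaleE tens_addE; apply/tens_eqP.
elim: s => [|[v w] s IHs]; first exact: tens_refl.
rewrite /= scalerDl -[_ :: scale_seq _ _ ++ _]cat1s.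
rewrite -[X in tens_rel X _]cat1s -[(d *: v, w) :: _]cat1s.
apply: (tens_trans (tens_cat (tens_addl _ _ _) IHs)).
rewrite -[[:: _; _]]/([:: _] ++ [:: _]) -catA.
apply: tens_cat; first exact: tens_refl.
rewrite !catA; apply: tens_cat; last exact: tens_refl.
exact: tens_catC.
Qed.

Lemma tens_scale0 x : tens_scalev 0 x = tens0.
Proof.
elim/tensW: x => s; rewrite tens_scaleE; apply/tens_eqP.
elim: s => [|[v w] s IHs]; first exact: tens_refl.
rewrite /= scale0r.
exact: (@tens_cat F V W [:: (0, w)] [::] _ [::] (tens_zero w) IHs).
Qed.

Lemma tens_scale1 : left_id 1 tens_scalev.
Proof.
elim/tensW=> s; rewrite tens_scaleE /scale_seq.
by rewrite (eq_map (g := id)) ?map_id // => -[v w] /=; rewrite scale1r.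
Qed.

Lemma tens_addN : left_inverse tens0 tens_opp tens_add.
Proof.
move=> x; rewrite /tens_opp -[X in tens_add _ X]tens_scale1 -tens_scaleDl.
by rewrite addNr tens_scale0.
Qed.

HB.instance Definition _ :=
  GRing.isZmodule.Build tensor tens_addA tens_addC tens_add0 tens_addN.

Lemma tens_scaleA c d x : tens_scalev c (tens_scalev d x) = tens_scalev (c * d) x.
Proof.
elim/tensW: x => s; rewrite !tens_scaleE /scale_seq -map_comp.
by rewrite (eq_map (g := fun p => ((c * d) *: p.1, p.2))) // => p /=; rewrite scalerA.
Qed.

Lemma tens_scaleDr : right_distributive tens_scalev +%R.
Proof.
move=> c; elim/tensW=> s; elim/tensW=> t.
rewrite -[\pi_tensor s + \pi_tensor t]/(tens_add _ _) tens_addE !tens_scaleE.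
by rewrite -[RHS]/(tens_add _ _) tens_addE /scale_seq map_cat.
Qed.

HB.instance Definition _ :=
  GRing.Zmodule_isLmodule.Build F tensor tens_scaleA tens_scale1 tens_scaleDr
    (fun x c d => tens_scaleDl c d x).

Definition pure (v : V) (w : W) : tensor := \pi_tensor [:: (v, w)].

Lemma tens_ind (P : tensor -> Prop) :
  P 0 -> (forall v w x, P x -> P (pure v w + x)) -> forall x, P x.
Proof.
move=> P0 PD; elim/tensW; elim=> [|[v w] s IHs]; first exact: P0.
by have := PD v w _ IHs; rewrite -[_ + _]/(tens_add _ _) tens_addE.
Qed.

Lemma pure_linearl w : linear (pure^~ w).
Proof.
move=> c v v'; rewrite -[_ + _ in RHS]/(tens_add _ _).
rewrite -[_ *: _ in RHS]/(tens_scalev _ _) tens_scaleE tens_addE.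
by apply/tens_eqP; apply: tens_addl.
Qed.

Lemma pure_linearr v : linear (pure v).
Proof.
move=> c w w'; rewrite -[_ + _ in RHS]/(tens_add _ _).
rewrite -[_ *: _ in RHS]/(tens_scalev _ _) tens_scaleE tens_addE.
apply/tens_eqP; apply: (tens_trans (tens_addr _ _ _)).
apply: (@tens_cat F V W [:: _] _ [:: _]); last exact: tens_refl.
exact/tens_sym/tens_scale.
Qed.

Section Eval.
Variables (U : lmodType F) (f : V -> W -> U).

(* The map out of the tensor product induced by f, which is Sweedler's         *)
(* notation f(x^(1), x^(2)); meaningful for bilinear f, see tevalP.            *)
Definition teval (x : tensor) : U := \sum_(p <- repr x) f p.1 p.2.

Hypothesis f_linl : forall w, linear (f^~ w).
Hypothesis f_linr : forall v, linear (f v).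

Lemma teval_rel s t : tens_rel s t ->
  \sum_(p <- s) f p.1 p.2 = \sum_(p <- t) f p.1 p.2.
Proof.
have f0l w : f 0 w = 0.
  have := f_linl w (-1) 0 0.
  by rewrite /= scaleN1r addNr scaleNr scale1r addNr.
have f0r v : f v 0 = 0.
  have := f_linr v (-1) 0 0.
  by rewrite /= scaleN1r addNr scaleNr scale1r addNr.
elim=> {s t}.
- by [].
- by move=> s t _ ->.
- by move=> t s u _ -> _ ->.
- by move=> s s' t t' _ h1 _ h2; rewrite !big_cat h1 h2.
- by move=> s t; rewrite !big_cat /= addrC.
- move=> v v' w; rewrite !big_cons !big_nil !addr0 /=.
  by have := f_linl w 1 v v'; rewrite !scale1r.
- move=> v w w'; rewrite !big_cons !big_nil !addr0 /=.
  by have := f_linr v 1 w w'; rewrite !scale1r.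
- move=> c v w; rewrite !big_cons !big_nil !addr0 /=.
  have := f_linl w c v 0; have := f_linr v c w 0.
  by rewrite /= !addr0 f0l f0r !addr0 => -> ->.
- by move=> w; rewrite !big_cons !big_nil /= f0l addr0.
Qed.

Lemma teval_pi s : teval (\pi_tensor s) = \sum_(p <- s) f p.1 p.2.
Proof. exact/teval_rel/tens_repr. Qed.

Lemma teval_pure v w : teval (pure v w) = f v w.
Proof. by rewrite teval_pi big_seq1. Qed.

Lemma teval_linear : linear teval.
Proof.
move=> c; elim/tensW=> s; elim/tensW=> t.
rewrite -[_ + \pi_tensor t]/(tens_add _ _) -[_ *: \pi_tensor s]/(tens_scalev _ _).
rewrite tens_scaleE tens_addE !teval_pi big_cat /=; congr (_ + _).
rewrite big_map scaler_sumr; apply: eq_bigr => -[v w] _ /=.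
have := f_linl w c v 0; rewrite /= !addr0 => ->.
have := f_linl w (-1) 0 0.
by rewrite /= scaleN1r addNr scaleNr scale1r addNr => ->; rewrite addr0.
Qed.

Lemma tevalP (g : tensor -> U) :
  linear g -> (forall v w, g (pure v w) = f v w) -> g =1 teval.
Proof.
move=> glin gf; have elin := teval_linear.
have l0 (h : tensor -> U) : linear h -> h 0 = 0.
  by move=> /(_ (-1) 0 0); rewrite scaleN1r addNr scaleNr scale1r addNr.
apply: tens_ind => [|v w x IH]; first by rewrite !l0.
have := glin 1 (pure v w) x; have := elin 1 (pure v w) x.
by rewrite !scale1r => -> ->; rewrite gf teval_pure IH.
Qed.

End Eval.
End Tensor.

Arguments pure {F V W}.

Notation "V ⊗ W" := (tensor V%type W%type) (at level 40, left associativity) : type_scope.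
Notation "v ⊗ w" := (pure v w) (at level 40, left associativity) : ring_scope.
Notation "'\tsum_(' x , y <- t ) E" := (teval (fun x y => E) t)
  (at level 36, E at level 36, x name, y name,
   format "'\tsum_(' x ,  y  <-  t )  E") : ring_scope.

Section TensorMaps.
Variable F : fieldType.
Implicit Types U V W : lmodType F.

Definition tmap V W V' W' (f : V -> V') (g : W -> W') (t : V ⊗ W) : V' ⊗ W' :=
  \tsum_(x, y <- t) (f x ⊗ g y).

Definition tassoc V W U (t : V ⊗ (W ⊗ U)) : V ⊗ W ⊗ U :=
  \tsum_(x, yz <- t) \tsum_(y, z <- yz) (x ⊗ y ⊗ z).

Lemma lin_form V (v : V) : v != 0 -> exists2 f : V -> F, scalar f & f v = 1.
Proof.
move=> v0.
pose P (N : set V) :=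
  (forall (c : F) x y, N x -> N y -> N (c *: x + y)) /\ ~ N v.
have [N [[Nlin Nv] Nmax]] : exists N, P N /\ forall N', N `<` N' -> ~ P N'.
  apply: Zorn_bigcup => C CP Ctot; split; last by case=> X /CP [].
  move=> c x y [X CX Xx] [Y CY Yy].
  have [XY|YX] := Ctot _ _ CX CY.
    by exists Y => //; have [Ylin _] := CP _ CY; apply: Ylin => //; apply: XY.
  by exists X => //; have [Xlin _] := CP _ CX; apply: Xlin => //; apply: YX.
have N0 : N 0.
  apply: contrapT => N0; apply: (Nmax [set 0]); last first.
    split=> [c x y -> ->|/= /eqP]; first by rewrite scaler0 addr0.
    by rewrite (negbTE v0).
  have Nempty x : ~ N x.
    move=> Nx; apply: N0; have := Nlin (-1) x x Nx Nx.
    by rewrite scaleN1r addNr.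
  by split=> [x /Nempty//|/(_ 0 erefl)].
have NZ c x : N x -> N (c *: x).
  by move=> Nx; rewrite -[_ *: _]addr0; apply: Nlin.
have ND x y : N x -> N y -> N (x + y).
  by move=> Nx Ny; rewrite -[x]scale1r; apply: Nlin.
have Nex a : exists c : F, N (a - c *: v).
  apply: contrapT => Na.
  apply: (Nmax [set x | exists n c, N n /\ x = n + c *: a]).
    split=> [x Nx|sub]; first by exists x, 0; rewrite scale0r addr0.
    apply: Na; exists 0; rewrite scale0r subr0; apply: sub.
    by exists 0, 1; rewrite scale1r add0r.
  split=> [c _ _ [n [d [Nn ->]]] [m [e [Nm ->]]]|[n [c [Nn vE]]]].
    exists (c *: n + m), (c * d + e); split; first exact: Nlin.
    by rewrite scalerDr scalerA scalerDl addrACA.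
  have [c0|c0] := eqVneq c 0.
    by apply: Nv; rewrite vE c0 scale0r addr0.
  apply: Na; exists c^-1; rewrite vE scalerDr scalerA mulVf // scale1r.
  by rewrite opprD addrCA subrr addr0 -scaleN1r; apply: (NZ _ _ (NZ _ _ Nn)).
have [f fP] := choice Nex.
have Nuniq c : N (c *: v) -> c = 0.
  move=> Ncv; apply: contrapT => /eqP c0; apply: Nv.
  by rewrite -[v]scale1r -(mulVf c0) -scalerA; apply: NZ.
exists f => [c x y|]; apply/eqP; rewrite -subr_eq0; apply/eqP; apply: Nuniq.
  have -> : (f (c *: x + y) - (c * f x + f y)) *: v =
     (-1) *: (c *: x + y - f (c *: x + y) *: v)
     + (c *: (x - f x *: v) + (y - f y *: v)).
    have -> : c *: (x - f x *: v) + (y - f y *: v) =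
        c *: x + y - (c * f x + f y) *: v.
      by rewrite scalerBr scalerA addrACA -opprD -scalerDl.
    by rewrite scaleN1r opprB addrA subrK scalerBl.
  by apply: (ND _ _ (NZ _ _ (fP _))); apply: Nlin.
rewrite scalerBl scale1r -opprB -scaleN1r; exact: NZ.
Qed.

Lemma pure_neq0 V W (v : V) (w : W) : v != 0 -> w != 0 -> v ⊗ w != 0.
Proof.
move=> /lin_form [f flin fv] /lin_form [g glin gw]; apply/eqP => vw0.
pose h x y : F^o := f x * g y.
have hl y : linear (h^~ y).
  by move=> c x x'; rewrite /h flin mulrDl -mulrA.
have hr x : linear (h x).
  by move=> c y y'; rewrite /h glin mulrDr mulrCA.
have := teval_pure hl hr v w; rewrite vw0 /h fv gw mulr1.
have := teval_linear hl hr (-1) 0 0.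
rewrite scaleN1r addNr scaleNr scale1r addNr => -> /eqP.
by rewrite eq_sym oner_eq0.
Qed.

Lemma tlin_comb U V (I : Type) (s : seq I) (g : I -> U -> V) :
  (forall i, linear (g i)) -> linear (fun u => \sum_(i <- s) g i u).
Proof.
move=> glin c u v; rewrite scaler_sumr -big_split /=.
by apply: eq_bigr => i _; apply: glin.
Qed.

Lemma tmap_pure V W V' W' (f : {linear V -> V'}) (g : {linear W -> W'}) v w :
  tmap f g (v ⊗ w) = f v ⊗ g w.
Proof.
apply: teval_pure => [y|x] c u u' /=.
- by rewrite linearP pure_linearl.
- by rewrite linearP pure_linearr.
Qed.

Lemma tassoc_pure V W U (v : V) (w : W) (u : U) :
  tassoc (v ⊗ (w ⊗ u)) = v ⊗ w ⊗ u.
Proof.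
have l (x : V) (z : U) : linear (fun y : W => x ⊗ y ⊗ z).
  by move=> c y y'; rewrite pure_linearr pure_linearl.
have r (x : V) (y : W) : linear (fun z : U => x ⊗ y ⊗ z).
  by move=> c z z'; rewrite pure_linearr.
rewrite /tassoc teval_pure => [|yz|x].
- by rewrite teval_pure => [|z|y]; [by []|exact: l|exact: r].
- by apply: tlin_comb => p c x x'; rewrite !pure_linearl.
- by apply: teval_linear => [z|y]; [exact: l|exact: r].
Qed.

End TensorMaps.

Section TensorAlgebra.
Variables (F : fieldType) (A B : algType F).

Definition tens_mul (s t : A ⊗ B) : A ⊗ B :=
  \tsum_(a, b <- s) \tsum_(c, d <- t) ((a * c) ⊗ (b * d)).

Lemma tens_mul_aux1 (b : B) (c : A) (d : B) :
  linear (fun a : A => (a * c) ⊗ (b * d)).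
Proof. by move=> e x y; rewrite mulrDl -scalerAl pure_linearl. Qed.

Lemma tens_mul_aux2 (a : A) (c : A) (d : B) :
  linear (fun b : B => (a * c) ⊗ (b * d)).
Proof. by move=> e x y; rewrite mulrDl -scalerAl pure_linearr. Qed.

Lemma tens_mul_aux3 (a : A) (b : B) (d : B) :
  linear (fun c : A => (a * c) ⊗ (b * d)).
Proof. by move=> e x y; rewrite mulrDr -scalerAr pure_linearl. Qed.

Lemma tens_mul_aux4 (a : A) (b : B) (c : A) :
  linear (fun d : B => (a * c) ⊗ (b * d)).
Proof. by move=> e x y; rewrite mulrDr -scalerAr pure_linearr. Qed.

Lemma tens_mul_linl t : linear (tens_mul^~ t).
Proof.
apply: teval_linear => [b|a]; apply: tlin_comb => -[c d] /=.
- exact: tens_mul_aux1.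
- exact: tens_mul_aux2.
Qed.

Lemma tens_mul_linr s : linear (tens_mul s).
Proof.
apply: tlin_comb => -[a b] /=; apply: teval_linear => [d|c].
- exact: tens_mul_aux3.
- exact: tens_mul_aux4.
Qed.

Lemma tens_mul_pure (a c : A) (b d : B) :
  tens_mul (a ⊗ b) (c ⊗ d) = (a * c) ⊗ (b * d).
Proof.
rewrite /tens_mul teval_pure => [|{}b|{}a].
- by rewrite teval_pure // => *; [apply: tens_mul_aux3|apply: tens_mul_aux4].
- by apply: tlin_comb => p; apply: tens_mul_aux1.
- by apply: tlin_comb => p; apply: tens_mul_aux2.
Qed.

Lemma tens_mulDl : left_distributive tens_mul +%R.
Proof. by move=> x y z; have := tens_mul_linl z 1 x y; rewrite !scale1r. Qed.

Lemma tens_mulDr : right_distributive tens_mul +%R.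
Proof. by move=> x y z; have := tens_mul_linr x 1 y z; rewrite !scale1r. Qed.

Lemma tens_mul0l x : tens_mul 0 x = 0.
Proof.
have := tens_mul_linl x (-1) 0 0.
by rewrite /= scaleN1r addNr scaleNr scale1r addNr.
Qed.

Lemma tens_mul0r x : tens_mul x 0 = 0.
Proof.
have := tens_mul_linr x (-1) 0 0.
by rewrite /= scaleN1r addNr scaleNr scale1r addNr.
Qed.

Lemma tens_mulA : associative tens_mul.
Proof.
move=> x y z; elim/tens_ind: x => [|a b x IHx]; first by rewrite !tens_mul0l.
rewrite !tens_mulDl IHx; congr (_ + _) => {x IHx}.
elim/tens_ind: y => [|c d y IHy]; first by rewrite tens_mul0r !tens_mul0l tens_mul0r.
rewrite tens_mulDl !tens_mulDr tens_mulDl IHy; congr (_ + _) => {y IHy}.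
elim/tens_ind: z => [|e f z IHz]; first by rewrite !tens_mul0r.
by rewrite !tens_mulDr IHz !tens_mul_pure !mulrA.
Qed.

Lemma tens_mul1l : left_id (1 ⊗ 1) tens_mul.
Proof.
move=> x; elim/tens_ind: x => [|a b x IHx]; first by rewrite tens_mul0r.
by rewrite tens_mulDr IHx tens_mul_pure !mul1r.
Qed.

Lemma tens_mul1r : right_id (1 ⊗ 1) tens_mul.
Proof.
move=> x; elim/tens_ind: x => [|a b x IHx]; first by rewrite tens_mul0l.
by rewrite tens_mulDl IHx tens_mul_pure !mulr1.
Qed.

Lemma tens_oner_neq0 : 1 ⊗ 1 != 0 :> A ⊗ B.
Proof. by apply: pure_neq0; apply: oner_neq0. Qed.

HB.instance Definition _ := GRing.Zmodule_isNzRing.Build (tensor A B)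
  tens_mulA tens_mul1l tens_mul1r tens_mulDl tens_mulDr tens_oner_neq0.

Lemma tens_scaleAl (c : F) (x y : A ⊗ B) : c *: (x * y) = (c *: x) * y.
Proof.
by have := tens_mul_linl y c x 0; rewrite /= !addr0 tens_mul0l addr0 => <-.
Qed.

Lemma tens_scaleAr (c : F) (x y : A ⊗ B) : c *: (x * y) = x * (c *: y).
Proof.
by have := tens_mul_linr x c y 0; rewrite /= !addr0 tens_mul0r addr0 => <-.
Qed.

HB.instance Definition _ := GRing.Lmodule_isLalgebra.Build F (tensor A B) tens_scaleAl.
HB.instance Definition _ := GRing.Lalgebra_isAlgebra.Build F (tensor A B) tens_scaleAr.

End TensorAlgebra.

HB.mixin Record isCoalgebra (F : fieldType) C of GRing.Lmodule F C := {
  comul : {linear C -> tensor C C};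
  counit : {scalar C};
  comulA : forall a : C, tmap comul id (comul a) = tassoc (tmap id comul (comul a));
  counitl : forall a : C, \tsum_(x, y <- comul a) (counit x *: y) = a;
  counitr : forall a : C, \tsum_(x, y <- comul a) (counit y *: x) = a
}.

#[short(type="coalgType")]
HB.structure Definition Coalgebra (F : fieldType) :=
  {C of GRing.Lmodule F C & isCoalgebra F C}.

Notation Δ := comul.
Notation ε := counit.

(* Since algType includes 1 != 0, the zero algebra is excluded.                *)
HB.mixin Record isWeakHopf (F : fieldType) A of GRing.Algebra F A & Coalgebra F A := {
  antipode : {linear A -> A};
  comulM : forall a b : A, Δ (a * b) = Δ a * Δ b;
  comul1l : tmap Δ id (Δ (1 : A)) =
    (Δ (1 : A) ⊗ (1 : A)) * tassoc ((1 : A) ⊗ Δ (1 : A));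
  comul1r : tmap Δ id (Δ (1 : A)) =
    tassoc ((1 : A) ⊗ Δ (1 : A)) * (Δ (1 : A) ⊗ (1 : A));
  counitMl : forall a b c : A,
    ε (a * b * c) = \tsum_(x, y <- Δ b) (ε (a * x) * ε (y * c) : F^o);
  counitMr : forall a b c : A,
    ε (a * b * c) = \tsum_(x, y <- Δ b) (ε (a * y) * ε (x * c) : F^o);
  antipoder : forall a : A,
    \tsum_(x, y <- Δ a) (x * antipode y) =
    \tsum_(u, v <- Δ (1 : A)) (ε (u * a) *: v);
  antipodel : forall a : A,
    \tsum_(x, y <- Δ a) (antipode x * y) =
    \tsum_(u, v <- Δ (1 : A)) (ε (a * v) *: u);
  antipodeK : forall a : A,
    \tsum_(xy, z <- tmap Δ id (Δ a))
      \tsum_(x, y <- xy) (antipode x * y * antipode z) = antipode a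
}.

#[short(type="weakHopfType")]
HB.structure Definition WeakHopf (F : fieldType) :=
  {A of GRing.Algebra F A & Coalgebra F A & isWeakHopf F A}.

Definition target_counit (F : fieldType) (A : weakHopfType F) (a : A) : A :=
  \tsum_(x, y <- Δ a) (x * antipode y).
Notation ε_t := target_counit.

HB.mixin Record isWeakHopfMorphism (F : fieldType) (A B : weakHopfType F)
    (f : A -> B) := {
  comul_morph : forall a, Δ (f a) = tmap f f (Δ a);
  counit_morph : forall a, ε (f a) = ε a;
  antipode_morph : forall a, antipode (f a) = f (antipode a)
}.

HB.structure Definition WeakHopfMorphism (F : fieldType) (A B : weakHopfType F) :=
  {f of @GRing.LRMorphism F A B *:%R f & isWeakHopfMorphism F A B f}.

Notation "{ 'whmorphism' A -> B }" := (WeakHopfMorphism.type A B)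
  (at level 0, A at level 98, B at level 99,
   format "{ 'whmorphism'  A  ->  B }") : type_scope.

(* The restriction of scalars k^* M.                                           *)
Definition restr (A B : pzRingType) (k : {rmorphism A -> B}) (M : lmodType B) : Type := M.

Section Restriction.
Variables (A B : pzRingType) (k : {rmorphism A -> B}) (M : lmodType B).

HB.instance Definition _ := GRing.Zmodule.on (restr k M).

Definition restr_scale (a : A) (m : restr k M) : restr k M := k a *: (m : M).

Lemma restr_scaleA a b m : restr_scale a (restr_scale b m) = restr_scale (a * b) m.
Proof. by rewrite /restr_scale scalerA rmorphM. Qed.

Lemma restr_scale1 : left_id 1 restr_scale.
Proof. by move=> m; rewrite /restr_scale rmorph1 scale1r. Qed.

Lemma restr_scaleDr : right_distributive restr_scale +%R.
Proof. by move=> a m n; rewrite /restr_scale scalerDr. Qed.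

Lemma restr_scaleDl m : {morph restr_scale^~ m : a b / a + b}.
Proof. by move=> a b; rewrite /restr_scale rmorphD scalerDl. Qed.

HB.instance Definition _ := GRing.Zmodule_isLmodule.Build A (restr k M)
  restr_scaleA restr_scale1 restr_scaleDr restr_scaleDl.

End Restriction.

Section Modules.
Variables (B : pzRingType) (M : lmodType B).

Definition is_submodule (N : set M) :=
  N 0 /\ forall (b : B) x y, N x -> N y -> N (b *: x + y).

Definition is_simple_submodule (N : set M) :=
  [/\ is_submodule N, N <> [set 0] &
      forall N', is_submodule N' -> N' `<=` N -> N' = [set 0] \/ N' = N].

(* M is an internal direct sum of simple submodules.                           *)
Definition semisimple_module :=
  exists (I : eqType) (N : I -> set M),
  [/\ forall i, is_simple_submodule (N i),
      forall m, exists (s : seq I) (x : I -> M),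
        (forall i, N i (x i)) /\ m = \sum_(i <- s) x i &
      forall (s : seq I) (x : I -> M), uniq s -> (forall i, N i (x i)) ->
        \sum_(i <- s) x i = 0 -> forall i, i \in s -> x i = 0].

End Modules.

Definition semisimple (B : pzRingType) := semisimple_module (B^o : lmodType B).

Section RepInv.
Variable F : fieldType.

(* A B-module is an F-space through the unit map c |-> c *: 1 of B.            *)
Definition fin_dim (B : algType F) (M : lmodType B) :=
  exists (n : nat) (e : 'I_n -> M),
    forall m, exists c : 'I_n -> F, m = \sum_(i < n) (c i *: 1 : B) *: e i.

(* The F-span of the products s x with s in S and x in X.                      *)
Definition span_mul (B : algType F) (M : lmodType B) (S : set B) (X : set M) : set M :=
  [set m | exists (n : nat) (c : 'I_n -> F) (s : 'I_n -> B) (x : 'I_n -> M),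
     [/\ forall i, S (s i), forall i, X (x i) &
         m = \sum_(i < n) (c i *: 1 : B) *: (s i *: x i)]].

Definition Inv (A : weakHopfType F) (M : lmodType A) : set M :=
  [set m | forall a : A, a *: m = ε_t a *: m].

Arguments Inv A M : clear implicits.

Definition Inv_normal_at (A B : weakHopfType F) (k : {whmorphism A -> B})
    (M : lmodType B) :=
  span_mul setT (Inv A (restr k M) : set M) =
  span_mul (range k) (Inv A (restr k M) : set M).

Definition Inv_normal (A B : weakHopfType F) (k : {whmorphism A -> B}) :=
  forall M : lmodType B, fin_dim M -> Inv_normal_at k M.

End RepInv.

Arguments Inv {F} A M _.

(* Main.v *)
Require Import Defs.
From HB Require Import structures.
From mathcomp Require Import all_boot all_order all_algebra.
From mathcomp Require Import boolp classical_sets.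

(** Over a semisimple ring [B] every cyclic module [B m] is a copy of a left
    ideal [B e]: the annihilator of [m] is a left ideal, it has a complement,
    and the component [e] of [1] in that complement satisfies [e m = m] and
    [ann(m) e = 0] (lemma [cyclic_retract]).  The point is that the property of
    being invariant only says that certain elements [k(a) - k(ε_t(a))] of [B]
    annihilate [m]; hence if [m] is invariant in [M], then [e] is invariant in
    the regular module.  By hypothesis [b e] is then a combination of products
    [k(a) y] with [y] invariant in [B].  The map [b |-> b m] from [B] to [M] is
    [B]-linear, so it preserves invariants, and it sends [e] to [m]; applying
    it to the expression of [b e] exhibits [b m = b e m] as a combination of
    products [k(a) (y m)] with [y m] invariant in [M].

    In other words, a module over a semisimple ring is projective, so that its
    elements can be moved to free modules and back by homomorphisms; treating
    one element at a time, a single cyclic module is all that has to be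
    split. *)

Set Implicit Arguments.
Unset Strict Implicit.
Unset Printing Implicit Defensive.

Import GRing.Theory.

Local Open Scope classical_set_scope.
Local Open Scope ring_scope.

Section Submodules.
Variables (B : pzRingType) (M : lmodType B).
Implicit Types (L N S : set M) (m x y : M).

Lemma submoduleD N x y : is_submodule N -> N x -> N y -> N (x + y).
Proof. by case=> _ h Nx Ny; rewrite -[x]scale1r; apply: h. Qed.

Lemma submoduleZ N b x : is_submodule N -> N x -> N (b *: x).
Proof. by case=> N0 h Nx; rewrite -[_ *: _]addr0; apply: h. Qed.

Lemma submoduleB N x y : is_submodule N -> N x -> N y -> N (x - y).
Proof.
by move=> hN Nx Ny; rewrite -scaleN1r; apply: submoduleD => //; apply: submoduleZ.
Qed.

Definition submodule_add L N : set M := [set m | exists2 x, L x & N (m - x)].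

Lemma submodule_add_is_submodule L N :
  is_submodule L -> is_submodule N -> is_submodule (submodule_add L N).
Proof.
move=> hL hN; split=> [|b m m' [x Lx Nx] [y Ly Ny]].
  by exists 0; [case: hL | rewrite subr0; case: hN].
exists (b *: x + y); first by case: hL => _; apply.
rewrite opprD addrACA -scalerBr.
by case: hN => _; apply.
Qed.

Lemma submodule_addl L N : is_submodule N -> L `<=` submodule_add L N.
Proof. by move=> [N0 _] x Lx; exists x; rewrite ?subrr. Qed.

Lemma submodule_addr L N : is_submodule L -> N `<=` submodule_add L N.
Proof. by move=> [L0 _] x Nx; exists 0; rewrite ?subr0. Qed.

(** A simple [S] meets [L + N] in [0] or is contained in it; in the first case
    [S] can be adjoined to [N] without creating an intersection with [L]. *)
Lemma independent_extend L N S :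
    is_submodule L -> is_submodule N -> is_simple_submodule S ->
    (forall x, L x -> N x -> x = 0) ->
  exists N', [/\ is_submodule N', N `<=` N', S `<=` submodule_add L N'
               & forall x, L x -> N' x -> x = 0].
Proof.
move=> hL hN [hS _ Smin] LN0.
have hLN := submodule_add_is_submodule hL hN.
have hI : is_submodule (S `&` submodule_add L N).
  case: (hS) (hLN) => S0 SZ [LN00 LNZ]; split=> [|b x y [Sx Lx] [Sy Ly]] //.
  by split; [apply: SZ | apply: LNZ].
have [I0|IS] := Smin _ hI (@subIsetl _ _ _).
- exists (submodule_add N S); split.
  + exact: submodule_add_is_submodule.
  + exact: submodule_addl.
  + by move=> x Sx; apply: submodule_addr => //; apply: submodule_addr.
  + move=> x Lx [n Nn Sxn].
    have xn0 : x - n = 0.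
      have : (S `&` submodule_add L N) (x - n).
        split=> //; apply: submoduleB => //.
          exact: submodule_addl.
        exact: submodule_addr.
      by rewrite I0.
    by apply: LN0 => //; move/eqP: xn0; rewrite subr_eq0 => /eqP ->.
- by exists N; split=> // x; rewrite -[X in X x]IS => -[].
Qed.

(** A finite form of the existence of complements, which needs no maximality
    principle: treat the simple summands that occur in [m] one after the
    other. *)
Lemma semisimple_split L m : semisimple_module M -> is_submodule L ->
  exists N, [/\ is_submodule N, forall x, L x -> N x -> x = 0
              & submodule_add L N m].
Proof.
move=> [I [S [hS Sgen _]]] hL; have [s [x [Sx ->]]] := Sgen m.
have [N [hN LN0 sLN]] : exists N, [/\ is_submodule N,
    forall x, L x -> N x -> x = 0
    & forall i, i \in s -> S i `<=` submodule_add L N].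
  elim: s => [|j s [N [hN LN0 sLN]]].
    exists [set 0]; split=> //; split=> // b y z -> ->.
    by rewrite scaler0 addr0.
  have [N' [hN' NN' jLN' LN'0]] := independent_extend hL hN (hS j) LN0.
  exists N'; split=> // i; rewrite inE => /predU1P[-> //|/sLN iLN] y /iLN.
  by case=> z Lz Nyz; exists z => //; apply: NN'.
have hLN := submodule_add_is_submodule hL hN.
exists N; split=> //; rewrite big_seq.
elim/big_rec: _ => [|i y si LNy]; first by case: hLN.
by apply: submoduleD => //; apply: sLN si _ _.
Qed.

End Submodules.

(** The elements [e] and [1 - e] are the components of [1] in a complement of
    the annihilator of [m] and in the annihilator itself. *)
Lemma cyclic_retract (B : pzRingType) (M : lmodType B) (m : M) :
  semisimple B ->
  exists2 e : B, e *: m = m & forall b : B, b *: m = 0 -> b * e = 0.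
Proof.
move=> ssB; pose L : set (B^o : lmodType B) := [set b : B | b *: m = 0].
have hL : is_submodule L.
  split=> [|b x y]; first by rewrite /L /= scale0r.
  rewrite /L /= => xm ym.
  by rewrite scalerDl -[b *: x]/(b * x) -scalerA xm ym scaler0 addr0.
have [N [hN LN0 [f fm Nf]]] := @semisimple_split B B^o L 1 ssB hL.
exists (1 - f : B); first by rewrite scalerBl scale1r fm subr0.
move=> b bm; apply: LN0; last exact: (submoduleZ b hN Nf).
(* b e = b - b f, and both terms kill m. *)
by rewrite /L /= mulrBr mulr1 scalerBl bm -scalerA fm scaler0 subr0.
Qed.

Section SpanMul.
Variables (F : fieldType) (B : algType F).
Implicit Types (M : lmodType B) (S : set B).

Lemma span_mul_incl M S (X : set M) b x : S b -> X x -> span_mul S X (b *: x).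
Proof.
move=> Sb Xx; exists 1%N, (fun=> 1), (fun=> b), (fun=> x).
by split=> //; rewrite big_ord1 !scale1r.
Qed.

Lemma span_mulD M S (X : set M) u v :
  span_mul S X u -> span_mul S X v -> span_mul S X (u + v).
Proof.
move=> [n [c [s [x [Ss Xx ->]]]]] [n' [c' [s' [x' [Ss' Xx' ->]]]]].
pose glue T (f : 'I_n -> T) (f' : 'I_n' -> T) (i : 'I_(n + n')) :=
  match split i with inl j => f j | inr j => f' j end.
exists (n + n')%N, (glue _ c c'), (glue _ s s'), (glue _ x x').
split; rewrite /glue.
- by move=> i; case: (split i).
- by move=> i; case: (split i).
- rewrite big_split_ord /=; congr (_ + _); apply: eq_bigr => i _.
    by rewrite (unsplitK (inl i)).
  by rewrite (unsplitK (inr i)).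
Qed.

Lemma span_mulZ M S (X : set M) (c : F) u :
  span_mul S X u -> span_mul S X ((c *: 1 : B) *: u).
Proof.
move=> [n [d [s [x [Ss Xx ->]]]]]; exists n, (fun i => c * d i), s, x.
split=> //; rewrite scaler_sumr; apply: eq_bigr => i _.
by rewrite scalerA -scalerAl mul1r [c *: _]scalerA.
Qed.

Lemma span_mul_sum M S (X : set M) n (u : 'I_n -> M) :
  (forall i, span_mul S X (u i)) -> span_mul S X (\sum_(i < n) u i).
Proof.
move=> Su; elim/big_rec: _ => [|i v _ Sv]; last exact: span_mulD.
by exists 0%N, (fun=> 0), (fun=> 0), (fun=> 0); split; [case|case|rewrite big_ord0].
Qed.

Lemma span_mul_subl M S S' (X : set M) :
  S `<=` S' -> span_mul S X `<=` span_mul S' X.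
Proof.
move=> SS' m [n [c [s [x [Ss Xx ->]]]]]; exists n, c, s, x.
by split=> // i; apply/SS'/Ss.
Qed.

Lemma span_mul_linear M M' S (X : set M) (X' : set M') (f : M -> M') :
    linear f -> (forall x, X x -> X' (f x)) ->
  forall m, span_mul S X m -> span_mul S X' (f m).
Proof.
move=> flin fX _ [n [c [s [x [Ss Xx ->]]]]].
have f0 : f 0 = 0 by have := flin (-1) 0 0; rewrite !scaleN1r !addNr.
have fD y z : f (y + z) = f y + f z by rewrite -[y]scale1r flin !scale1r.
have fZ b y : f (b *: y) = b *: f y by rewrite -[b *: y]addr0 flin f0 addr0.
exists n, c, s, (f \o x); split=> // [i|]; first exact: fX.
by rewrite (big_morph f fD f0); apply: eq_bigr => i _; rewrite !fZ.
Qed.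

End SpanMul.

Section InvNormal.
Variables (F : fieldType) (A B : weakHopfType F) (k : {whmorphism A -> B}).

(** Invariance of [m] under [A] is a family of linear equations over [B], so it
    passes from [m] to any [n] that satisfies all the relations of [m]. *)
Lemma Inv_annihilator (M N : lmodType B) (m : M) (n : N) :
    (forall b : B, b *: m = 0 -> b *: n = 0) ->
  Inv A (restr k M) m -> Inv A (restr k N) n.
Proof.
move=> mn mInv a; apply/eqP; rewrite -subr_eq0 -[_ - _]scalerBl.
apply/eqP; apply: (mn (k (a - ε_t a))); have := mInv a.
rewrite -[a *: _]/(k a *: m) -[ε_t a *: _]/(k (ε_t a) *: m).
by rewrite rmorphB scalerBl => ->; rewrite subrr.
Qed.

Lemma Inv_normal_at_regular (M : lmodType B) :
  semisimple B -> Inv_normal_at k B^o -> Inv_normal_at k M.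
Proof.
move=> ssB kB; apply/seteqP; split; last exact: span_mul_subl.
move=> _ [n [c [b [m [_ mInv ->]]]]].
apply: span_mul_sum => i; apply: span_mulZ.
have [e em ann_e] := cyclic_retract (m i) ssB.
have eInv : Inv A (restr k B^o) e :=
    @Inv_annihilator M B^o (m i) e ann_e (mInv i).
have : span_mul (range k) (Inv A (restr k B^o) : set B^o) (b i * e).
  by rewrite -[X in X _]kB; apply: (@span_mul_incl F B B^o).
(* Push the expression of b e forward along right multiplication by m. *)
have -> : b i *: m i = (b i * e) *: m i by rewrite -scalerA em.
apply: (@span_mul_linear F B B^o M _ _ _ (fun y : B => y *: m i)).
- by move=> d y z; rewrite scalerDl -scalerA.
- move=> y; apply: (@Inv_annihilator B^o M y) => d dy.
  by rewrite scalerA -[d * y]/(d *: (y : B^o)) dy scale0r.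
Qed.

End InvNormal.

Theorem proposition4p6 (F : fieldType) (A B : weakHopfType F)
    (k : {whmorphism A -> B}) (hss : semisimple B)
    (hB : Inv_normal_at k B^o) :
  Inv_normal k.
Proof. by move=> M _; apply: Inv_normal_at_regular. Qed.
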